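(* Let $f:\mathbb{F}_2^{2m}\to\mathbb{F}_2$ be bent. For all $b,c\in\mathbb{F}_2^{2m}$, $$\mathrm{wc}\big(x\mapsto f(x+b)+\langle c,x\rangle+f(b)\big)=f(b)+\langle c,b\rangle+\tilde f(c).$$ That is, the weight class matrix $M_{wc}(f)$ equals the matrix $M_D(f)$ given by $M_D(f)_{c,b}=f(b)+\langle c,b\rangle+\tilde f(c)$ (the incidence matrix of the SDP design of $f$).
   Context: $\langle x,y\rangle=\sum_ix_iy_i$ over $\mathbb{F}_2$. $W_f(x)=\sum_y(-1)^{f(y)+\langle x,y\rangle}$; $f$ is bent iff $|W_f|\equiv 2^m$; the dual $\tilde f$ is given by $(-1)^{\tilde f(x)}=2^{-m}W_f(x)$. A bent function $g$ on $\mathbb{F}_2^{2m}$ has weight class number $\mathrm{wc}(g)=0$ if $|\{x:g(x)=1\}|=2^{2m-1}-2^{m-1}$ and $\mathrm{wc}(g)=1$ if it equals $2^{2m-1}+2^{m-1}$. The weight class matrix is $M_{wc}(f)_{c,b}:=\mathrm{wc}(x\mapsto f(x+b)+\langle c,x\rangle+f(b))$, indexed by $c,b\in\mathbb{F}_2^{2m}$. *)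

(* Defs.v *)
From HB Require Import structures.
From mathcomp Require Import all_boot all_order all_algebra.
From mathcomp Require Import ring lra zify.
Set Implicit Arguments.
Unset Strict Implicit.
Unset Printing Implicit Defensive.
Import Order.TTheory GRing.Theory Num.Theory.
Local Open Scope ring_scope.

Notation F2vec n := 'rV['F_2]_n.

Definition dotF2 n (x y : F2vec n) : 'F_2 := \sum_i x 0 i * y 0 i.

(* Elements of 'F_2 are ordinals, so a : 'F_2 is also the exponent 0 or 1. *)
Definition signF2 (a : 'F_2) : int := (-1) ^+ (a : nat).

Definition walsh n (f : F2vec n -> 'F_2) (x : F2vec n) : int :=
  \sum_(y : F2vec n) signF2 (f y + dotF2 x y).

Definition bent m (f : F2vec (2 * m) -> 'F_2) : Prop :=
  forall x, `|walsh f x| = 2 ^+ m.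

Record bent_fun (m : nat) := BentFun {
  bent_val :> F2vec (2 * m) -> 'F_2;
  bent_valP : bent bent_val }.

Definition weight n (g : F2vec n -> 'F_2) : nat := #|[set x | g x == 1]|.

(* Powers of 2 in rat with exponents in int: for m = 0 the two weights are
   1/2 - 1/2 = 0 and 1/2 + 1/2 = 1. *)
Definition low_weight (m : nat) : rat :=
  (2 : rat) ^ ((2 * m)%N%:Z - 1) - (2 : rat) ^ (m%:Z - 1).

Definition high_weight (m : nat) : rat :=
  (2 : rat) ^ ((2 * m)%N%:Z - 1) + (2 : rat) ^ (m%:Z - 1).

(* A bent function has one of the two weights, see wc_eq0 and wc_eq1. *)
Definition wc m (g : bent_fun m) : 'F_2 :=
  if (weight g)%:Q == low_weight m then 0 else 1.

(* Its defining equation is dualP. *)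
Definition dual m (f : bent_fun m) (x : F2vec (2 * m)) : 'F_2 :=
  if walsh f x == 2 ^+ m then 0 else 1.

Lemma F2P (a : 'F_2) : a = 0 \/ a = 1.
Proof.
by case: a => [[|[|k]] // lt]; [left | right]; apply/val_inj.
Qed.

Lemma signF2D a b : signF2 (a + b) = signF2 a * signF2 b.
Proof. by case: (F2P a) => ->; case: (F2P b) => ->. Qed.

Lemma norm_signF2 a : `|signF2 a| = 1.
Proof. by case: (F2P a) => ->. Qed.

Lemma dotF2Dl n (x y z : F2vec n) : dotF2 (x + y) z = dotF2 x z + dotF2 y z.
Proof.
by rewrite -big_split; apply: eq_bigr => i _; rewrite mxE mulrDl.
Qed.

Lemma dotF2Dr n (x y z : F2vec n) : dotF2 x (y + z) = dotF2 x y + dotF2 x z.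
Proof.
by rewrite -big_split; apply: eq_bigr => i _; rewrite mxE mulrDr.
Qed.

Lemma walsh_translate n (f : F2vec n -> 'F_2) (b c x : F2vec n) :
  walsh (fun y => f (y + b) + dotF2 c y + f b) x =
  signF2 (f b + dotF2 (c + x) b) * walsh f (c + x).
Proof.
rewrite /walsh big_distrr /= [RHS](reindex_inj (addIr b)) /=.
apply: eq_bigr => y _; rewrite dotF2Dr !dotF2Dl !signF2D.
have sq a : signF2 a * signF2 a = 1 by case: (F2P a) => ->.
transitivity (signF2 (f (y + b)) * signF2 (dotF2 c y) * signF2 (f b) *
  signF2 (dotF2 x y) * (signF2 (dotF2 c b) * signF2 (dotF2 c b)) *
  (signF2 (dotF2 x b) * signF2 (dotF2 x b))); last by ring.
by rewrite !sq !mulr1.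
Qed.

Lemma bent_translate m (f : bent_fun m) (b c : F2vec (2 * m)) :
  bent (fun x => f (x + b) + dotF2 c x + f b).
Proof.
move=> x; rewrite walsh_translate normrM norm_signF2 mul1r.
exact: bent_valP.
Qed.

Definition translate m (f : bent_fun m) (b c : F2vec (2 * m)) : bent_fun m :=
  BentFun (bent_translate f b c).

Definition Mwc m (f : bent_fun m) : {ffun F2vec (2 * m) * F2vec (2 * m) -> 'F_2} :=
  [ffun cb => wc (translate f cb.2 cb.1)].

Definition MD m (f : bent_fun m) : {ffun F2vec (2 * m) * F2vec (2 * m) -> 'F_2} :=
  [ffun cb => f cb.2 + dotF2 cb.1 cb.2 + dual f cb.1].

Lemma bent_walsh m (f : bent_fun m) x :
  walsh f x = 2 ^+ m \/ walsh f x = - 2 ^+ m.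
Proof.
have := @bent_valP m f x; case: (ger0P (walsh f x)) => _ <-; first by left.
by right; rewrite opprK.
Qed.

Lemma intrX2 k : (2 ^+ k : int)%:~R = (2 : rat) ^+ k.
Proof. by rewrite rmorphXn. Qed.

Lemma dualP m (f : bent_fun m) x :
  (signF2 (dual f x))%:~R = ((2 : rat) ^+ m)^-1 * (walsh f x)%:~R.
Proof.
have p0 : ((2 : rat) ^+ m) != 0 by rewrite expf_neq0.
rewrite /dual; case: (bent_walsh f x) => ->.
  by rewrite eqxx intrX2 mulVf.
have -> : (- 2 ^+ m == 2 ^+ m :> int) = false.
  have p1 : 0 < 2 ^+ m :> int by rewrite exprn_gt0.
  by apply/negbTE/eqP => e; lia.
by rewrite !mulrNz intrX2 mulrN mulVf.
Qed.

Lemma walsh0 n (g : F2vec n -> 'F_2) :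
  walsh g 0 = 2 ^+ n - 2 * (weight g)%:Z.
Proof.
have d0 y : dotF2 (0 : F2vec n) y = 0.
  by apply: big1 => i _; rewrite mxE mul0r.
rewrite /walsh (eq_bigr (fun y => 1 - 2 * (g y == 1)%:R)) => [|y _]; last first.
  by rewrite d0 addr0; case: (F2P (g y)) => ->.
rewrite sumrB -mulr_sumr sumr_const card_mx card_Fp // mul1n natrX.
congr (_ - 2 * _); rewrite -natr_sum pmulrn intz /weight -sum1_card.
by congr (Posz _); rewrite [RHS]big_mkcond; apply: eq_bigr => y _; rewrite inE; case: eqP.
Qed.

Lemma bent_weight m (g : bent_fun m) :
  (weight g)%:Q = low_weight m \/ (weight g)%:Q = high_weight m.
Proof.
have /(congr1 (intr : int -> rat)) := walsh0 g.
rewrite /low_weight /high_weight !expfzDr // -!exprnP exprN1.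
rewrite rmorphB /= intrX2 intrM.
by case: (bent_walsh g 0) => ->; rewrite ?mulrNz intrX2 => e;
  [left | right]; lra.
Qed.

Lemma low_neq_high m : low_weight m != high_weight m.
Proof.
rewrite /low_weight /high_weight.
have : 0 < (2 : rat) ^ (m%:Z - 1) by rewrite exprz_gt0.
by move=> h; apply/eqP => e; lra.
Qed.

Lemma wc_eq0 m (g : bent_fun m) :
  (wc g == 0) = ((weight g)%:Q == low_weight m).
Proof. by rewrite /wc; case: ifP. Qed.

Lemma wc_eq1 m (g : bent_fun m) :
  (wc g == 1) = ((weight g)%:Q == high_weight m).
Proof.
rewrite /wc; have nlh := low_neq_high m.
case: (bent_weight g) => ->; first by rewrite eqxx (negbTE nlh).
by rewrite [high_weight m == low_weight m]eq_sym (negbTE nlh) !eqxx.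
Qed.

(* Main.v *)
(** By [walsh0] the weight of a bent function g is read off from W_g(0), so
    that wc(g) is the value at 0 of the dual of g. The Walsh transform of the
    translate x |-> f(x+b) + <c,x> + f(b) at 0 is
    (-1)^(f(b) + <c,b>) W_f(c), and comparing signs gives the theorem. *)

Require Import Defs.
From HB Require Import structures.
From mathcomp Require Import all_boot all_order all_algebra.
From mathcomp Require Import lra.
Import Order.TTheory GRing.Theory Num.Theory.
Local Open Scope ring_scope.

Lemma signF2_inj : injective signF2.
Proof. by move=> a b; case: (F2P a) => ->; case: (F2P b) => ->. Qed.

(** Division-free form of [dualP], so that signs can be compared within [int]. *)
Lemma walshE m (f : bent_fun m) x :
  walsh f x = signF2 (dual f x) * 2 ^+ m.
Proof.
rewrite /dual; case: eqP => [-> | ne]; first by rewrite mul1r.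
by case: (bent_walsh f x) => // ->; rewrite mulN1r.
Qed.

Lemma wc_dual0 m (g : bent_fun m) : wc g = dual g 0.
Proof.
have /(congr1 (intr : int -> rat)) := walsh0 g.
(* The integer test in [dual] is cast to [rat], where [low_weight] lives. *)
rewrite /wc /dual -(inj_eq (intr_inj (R := rat))) /low_weight.
rewrite !expfzDr // -!exprnP exprN1 rmorphB /= !intrX2 intrM => e.
(* Given [e], the two tests are equivalent linear equations. *)
by congr (if _ then _ else _); apply/eqP/eqP => h; lra.
Qed.

Lemma wc_translate m (f : bent_fun m) (b c : F2vec (2 * m)) :
  wc (translate f b c) = f b + dotF2 c b + dual f c.
Proof.
have n0 : 2 ^+ m != 0 :> int by rewrite expf_neq0.
(* Scaling the signs by [2 ^+ m] turns the left side into the Walsh value of the translate at 0. *)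
rewrite wc_dual0; apply: signF2_inj; apply: (mulIf n0).
by rewrite -walshE walsh_translate addr0 walshE mulrA -signF2D.
Qed.

Theorem mainTheorem8 (m : nat) (f : bent_fun m) :
  (forall b c : F2vec (2 * m),
     wc (translate f b c) = f b + dotF2 c b + dual f c) /\
  Mwc f = MD f.
Proof.
split; first exact: wc_translate.
by apply/ffunP => -[c b]; rewrite !ffunE wc_translate.
Qed.
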